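(* (Itô's theorem for non-commutative generalized Poisson algebras) Let $P$ be a non-commutative generalized Poisson algebra over $F$. If $A$ and $B$ are two abelian subalgebras of $P$ such that $P=A+B$, then $P$ is metatrivial.
   Context: The base field $F$ is algebraically closed of characteristic $0$. A non-commutative generalized Poisson algebra is $(P,\cdot,[\,,],D)$, where $(P,\cdot)$ is an associative algebra (not necessarily commutative, not assumed unital), $(P,[\,,])$ is a Lie algebra, $D:P\to P$ is a linear map that is a derivation of both $(P,\cdot)$ and $(P,[\,,])$, and for all $a,b,c\in P$ $$[a \cdot b, c] = a\cdot [b, c]+[a, c]\cdot b + a\cdot b\cdot D(c).$$ A subalgebra of $P$ is a linear subspace closed under both operations $\cdot$ and $[\,,]$. An algebra $(Q,\cdot,[\,,])$ is called abelian (or trivial) if both operations are trivial, i.e. $x\cdot y=[x,y]=0$ for all $x,y\in Q$. $P$ is called metatrivial (or strongly metabelian) if it is an extension of an abelian generalized Poisson algebra by another abelian generalized Poisson algebra; that is, there is a linear subspace $I\subseteq P$ with $P\cdot I\subseteq I$, $I\cdot P\subseteq I$, $[P,I]\subseteq I$ and $D(I)\subseteq I$, such that both $I$ and the quotient $P/I$ are abelian. Here $P=A+B$ means that every element of $P$ is a sum of an element of $A$ and an element of $B$ (the sum is not assumed direct). *)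

(* Defs.v *)
From HB Require Import structures.
From mathcomp Require Import all_boot all_order all_algebra.
From mathcomp Require Import generic_quotient ring_quotient.
From mathcomp Require Import boolp classical_sets.

Set Implicit Arguments.
Unset Strict Implicit.
Unset Printing Implicit Defensive.

Import GRing.Theory.
Local Open Scope ring_scope.
Local Open Scope quotient_scope.

Declare Scope gpoisson_scope.
Delimit Scope gpoisson_scope with GP.
Reserved Notation "x ** y" (at level 40, left associativity).
Reserved Notation "[lie x , y ]" (at level 0, x, y at level 99).

HB.mixin Record isNCGenPoisson (F : fieldType) P of GRing.Lmodule F P := {
  gp_mul : P -> P -> P;
  gp_lie : P -> P -> P;
  gp_der : P -> P;
  gp_mul_linearl : forall y, linear (gp_mul^~ y);
  gp_mul_linearr : forall x, linear (gp_mul x);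
  gp_lie_linearl : forall y, linear (gp_lie^~ y);
  gp_lie_linearr : forall x, linear (gp_lie x);
  gp_der_linear : linear gp_der;
  gp_mulA : associative gp_mul;
  gp_lie_alt : forall x, gp_lie x x = 0;
  gp_jacobi : forall x y z,
    gp_lie x (gp_lie y z) + gp_lie y (gp_lie z x) + gp_lie z (gp_lie x y) = 0;
  gp_der_mul : forall x y,
    gp_der (gp_mul x y) = gp_mul (gp_der x) y + gp_mul x (gp_der y);
  gp_der_lie : forall x y,
    gp_der (gp_lie x y) = gp_lie (gp_der x) y + gp_lie x (gp_der y);
  gp_leibniz : forall a b c,
    gp_lie (gp_mul a b) c =
      gp_mul a (gp_lie b c) + gp_mul (gp_lie a c) b
      + gp_mul (gp_mul a b) (gp_der c)
}.

#[short(type="ncGenPoissonType")]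
HB.structure Definition NCGenPoisson (F : fieldType) :=
  {P of isNCGenPoisson F P & GRing.Lmodule F P}.

Notation "x ** y" := (gp_mul x y) : gpoisson_scope.
Notation "[lie x , y ]" := (gp_lie x y) : gpoisson_scope.
Local Open Scope gpoisson_scope.

Section Subobjects.
Variables (F : fieldType) (P : ncGenPoissonType F).

(* [in A] is the boolean membership predicate of the arbitrary subset A. *)
Definition subspace (A : set P) : Prop := submod_closed [in A].

(* Subalgebras are not required to be stable under the derivation. *)
Definition subalgebra (A : set P) : Prop :=
  [/\ subspace A,
      forall x y, A x -> A y -> A (x ** y)
    & forall x y, A x -> A y -> A [lie x, y]].

Definition abelian_on (A : set P) : Prop :=
  forall x y, A x -> A y -> x ** y = 0 /\ [lie x, y] = 0.

Record gp_ideal := GPIdeal {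
  ideal_set :> set P;
  ideal_subspace : subspace ideal_set;
  ideal_mull : forall x u, ideal_set u -> ideal_set (x ** u);
  ideal_mulr : forall u x, ideal_set u -> ideal_set (u ** x);
  ideal_lie : forall x u, ideal_set u -> ideal_set [lie x, u];
  ideal_der : forall u, ideal_set u -> ideal_set (gp_der u)
}.

Definition ideal_pred (I : gp_ideal) : {pred P} := [in ideal_set I].

HB.instance Definition _ (I : gp_ideal) :=
  GRing.isZmodClosed.Build P (ideal_pred I)
    (GRing.submod_closedB (ideal_subspace I)).

End Subobjects.

Section Quotient.
Variables (F : fieldType) (P : ncGenPoissonType F) (I : gp_ideal P).

Definition gp_quot := @Quotient.quot P (ideal_pred I).
HB.instance Definition _ := GRing.Zmodule.on gp_quot.

Definition gp_pi (x : P) : gp_quot := \pi_gp_quot x.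
Definition gp_repr (u : gp_quot) : P := repr u.

Lemma gp_reprK : cancel gp_repr gp_pi. Proof. exact: reprK. Qed.

Lemma gp_pi_eq x y : gp_pi x = gp_pi y <-> ideal_set I (x - y).
Proof.
have /(congr1 is_true) := Quotient.idealrBE (ideal_pred I) x y.
rewrite in_setE => ->; split; first by move=> e; apply/eqP.
by move/eqP.
Qed.

Lemma gp_pi0 x : gp_pi x = 0 <-> ideal_set I x.
Proof.
have -> : 0 = gp_pi 0 by rewrite /gp_pi piE.
by rewrite gp_pi_eq subr0.
Qed.

Lemma gp_piD : {morph gp_pi : x y / x + y}.
Proof. by move=> x y; rewrite /gp_pi piE. Qed.

Lemma gp_reprpi x : ideal_set I (gp_repr (gp_pi x) - x).
Proof. by apply/gp_pi_eq; rewrite gp_reprK. Qed.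

Lemma gp_idealD x y : ideal_set I x -> ideal_set I y -> ideal_set I (x + y).
Proof.
move=> /mem_set Ix /mem_set Iy; have [_ h] := ideal_subspace I.
by rewrite -[x]scale1r -in_setE; apply: h.
Qed.

Lemma gp_idealZ a x : ideal_set I x -> ideal_set I (a *: x).
Proof.
move=> /mem_set Ix; have [I0 h] := ideal_subspace I.
by rewrite -[a *: x]addr0 -in_setE; apply: h.
Qed.

Definition quot_scale (a : F) (u : gp_quot) : gp_quot := gp_pi (a *: gp_repr u).
Definition quot_mul (u v : gp_quot) : gp_quot := gp_pi (gp_repr u ** gp_repr v).
Definition quot_lie (u v : gp_quot) : gp_quot :=
  gp_pi [lie gp_repr u, gp_repr v].
Definition quot_der (u : gp_quot) : gp_quot := gp_pi (gp_der (gp_repr u)).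

Let raddB (f : P -> P) : linear f -> forall x y, f (x - y) = f x - f y.
Proof. by move=> lf x y; rewrite addrC -scaleN1r lf scaleN1r addrC. Qed.

Lemma quot_scale_pi a x : quot_scale a (gp_pi x) = gp_pi (a *: x).
Proof. by apply/gp_pi_eq; rewrite -scalerBr; apply/gp_idealZ/gp_reprpi. Qed.

Lemma quot_mul_pi x y : quot_mul (gp_pi x) (gp_pi y) = gp_pi (x ** y).
Proof.
apply/gp_pi_eq; set x' := gp_repr _; set y' := gp_repr _.
rewrite -(subrKA (x' ** y)); apply: gp_idealD.
  by rewrite -(raddB (gp_mul_linearr x')); apply/ideal_mull/gp_reprpi.
by rewrite -(raddB (gp_mul_linearl y)); apply/ideal_mulr/gp_reprpi.
Qed.

Lemma gp_lieC (x y : P) : [lie x, y] = - [lie y, x].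
Proof.
have linD (f : P -> P) : linear f -> {morph f : u v / u + v}.
  by move=> lf u v; rewrite -[u]scale1r lf !scale1r.
apply/eqP; rewrite -addr_eq0; apply/eqP.
have := gp_lie_alt (x + y).
rewrite (linD _ (gp_lie_linearl _)) !(linD _ (gp_lie_linearr _)).
by rewrite !gp_lie_alt add0r addr0.
Qed.

Lemma quot_lie_pi x y : quot_lie (gp_pi x) (gp_pi y) = gp_pi [lie x, y].
Proof.
apply/gp_pi_eq; set x' := gp_repr _; set y' := gp_repr _.
rewrite -(subrKA [lie x', y]); apply: gp_idealD.
  by rewrite -(raddB (gp_lie_linearr x')); apply/ideal_lie/gp_reprpi.
rewrite -(raddB (gp_lie_linearl y)) gp_lieC -scaleN1r.
by apply/gp_idealZ/ideal_lie/gp_reprpi.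
Qed.

Lemma quot_der_pi x : quot_der (gp_pi x) = gp_pi (gp_der x).
Proof.
apply/gp_pi_eq; rewrite -(raddB gp_der_linear).
exact/ideal_der/gp_reprpi.
Qed.

Let pE := (quot_scale_pi, quot_mul_pi, quot_lie_pi, quot_der_pi).

Let quotP (Q : gp_quot -> Prop) : (forall x, Q (gp_pi x)) -> forall u, Q u.
Proof. by move=> h u; rewrite -[u]gp_reprK. Qed.

Fact quot_scalerA a b u :
  quot_scale a (quot_scale b u) = quot_scale (a * b) u.
Proof. by elim/quotP: u => x; rewrite !pE scalerA. Qed.

Fact quot_scale1r : left_id 1 quot_scale.
Proof. by elim/quotP => x; rewrite pE scale1r. Qed.

Fact quot_scalerDr : right_distributive quot_scale +%R.
Proof.
by move=> a; elim/quotP=> x; elim/quotP=> y; rewrite -gp_piD !pE scalerDr gp_piD.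
Qed.

Fact quot_scalerDl u : {morph quot_scale^~ u : a b / a + b}.
Proof. by elim/quotP: u => x a b; rewrite !pE scalerDl gp_piD. Qed.

HB.instance Definition _ := GRing.Zmodule_isLmodule.Build F gp_quot
  quot_scalerA quot_scale1r quot_scalerDr quot_scalerDl.

Lemma gp_pi_linear : linear gp_pi.
Proof. by move=> a x y; rewrite gp_piD -quot_scale_pi. Qed.

Fact quot_mul_linearl v : linear (quot_mul^~ v).
Proof.
elim/quotP: v => z a; elim/quotP=> x; elim/quotP=> y.
by rewrite -gp_pi_linear !pE -gp_pi_linear gp_mul_linearl.
Qed.

Fact quot_mul_linearr u : linear (quot_mul u).
Proof.
elim/quotP: u => z a; elim/quotP=> x; elim/quotP=> y.
by rewrite -gp_pi_linear !pE -gp_pi_linear gp_mul_linearr.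
Qed.

Fact quot_lie_linearl v : linear (quot_lie^~ v).
Proof.
elim/quotP: v => z a; elim/quotP=> x; elim/quotP=> y.
by rewrite -gp_pi_linear !pE -gp_pi_linear gp_lie_linearl.
Qed.

Fact quot_lie_linearr u : linear (quot_lie u).
Proof.
elim/quotP: u => z a; elim/quotP=> x; elim/quotP=> y.
by rewrite -gp_pi_linear !pE -gp_pi_linear gp_lie_linearr.
Qed.

Fact quot_der_linear : linear quot_der.
Proof.
move=> a; elim/quotP=> x; elim/quotP=> y.
by rewrite -gp_pi_linear !pE -gp_pi_linear gp_der_linear.
Qed.

Fact quot_mulA : associative quot_mul.
Proof.
by elim/quotP=> x; elim/quotP=> y; elim/quotP=> z; rewrite !pE gp_mulA.
Qed.

Fact quot_lie_alt u : quot_lie u u = 0.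
Proof.
elim/quotP: u => x; rewrite pE gp_lie_alt; apply/gp_pi0.
by have [I0 _] := ideal_subspace I; rewrite -in_setE.
Qed.

Fact quot_jacobi u v w :
  quot_lie u (quot_lie v w) + quot_lie v (quot_lie w u)
  + quot_lie w (quot_lie u v) = 0.
Proof.
elim/quotP: u => x; elim/quotP: v => y; elim/quotP: w => z.
rewrite !pE -!gp_piD gp_jacobi; apply/gp_pi0.
by have [I0 _] := ideal_subspace I; rewrite -in_setE.
Qed.

Fact quot_der_mul u v :
  quot_der (quot_mul u v) = quot_mul (quot_der u) v + quot_mul u (quot_der v).
Proof.
by elim/quotP: u => x; elim/quotP: v => y; rewrite !pE gp_der_mul gp_piD.
Qed.

Fact quot_der_lie u v :
  quot_der (quot_lie u v) = quot_lie (quot_der u) v + quot_lie u (quot_der v).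
Proof.
by elim/quotP: u => x; elim/quotP: v => y; rewrite !pE gp_der_lie gp_piD.
Qed.

Fact quot_leibniz u v w :
  quot_lie (quot_mul u v) w =
    quot_mul u (quot_lie v w) + quot_mul (quot_lie u w) v
    + quot_mul (quot_mul u v) (quot_der w).
Proof.
elim/quotP: u => x; elim/quotP: v => y; elim/quotP: w => z.
by rewrite !pE -!gp_piD gp_leibniz.
Qed.

HB.instance Definition _ := isNCGenPoisson.Build F gp_quot
  quot_mul_linearl quot_mul_linearr quot_lie_linearl quot_lie_linearr
  quot_der_linear quot_mulA quot_lie_alt quot_jacobi quot_der_mul quot_der_lie
  quot_leibniz.

Lemma gp_pi_mul : {morph gp_pi : x y / x ** y}.
Proof. by move=> x y; rewrite -quot_mul_pi. Qed.

Lemma gp_pi_lie : {morph gp_pi : x y / [lie x, y]}.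
Proof. by move=> x y; rewrite -quot_lie_pi. Qed.

Lemma gp_pi_der : {morph gp_pi : x / gp_der x}.
Proof. by move=> x; rewrite -quot_der_pi. Qed.

End Quotient.

Definition metatrivial (F : fieldType) (P : ncGenPoissonType F) : Prop :=
  exists I : gp_ideal P,
    abelian_on (ideal_set I) /\ abelian_on [set: gp_quot I].

(* Main.v *)
Require Import Defs.
From mathcomp Require Import all_boot all_order all_algebra.
From mathcomp Require Import boolp classical_sets.

Local Open Scope classical_set_scope.
Local Open Scope ring_scope.

(** Let I be the linear span of all products x ** y and [lie x, y].  It is a
    D-stable ideal with abelian quotient, so everything amounts to showing that
    I is itself abelian.  Expanding along P = A + B, the space I is spanned by
    the elements ab, ba and [a,b] with a in A and b in B, so only products of
    two elements of these three shapes have to vanish.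

    Two mechanisms give this.

    The associative one: A P B = B P A = 0, because the A-part of the middle
    factor is killed by A and its B-part by B ([sandwich]).

    The mixed one is a slide rule.  If m is either the product or the bracket,
    then m([a,c],a') = - m(a,[a',c]) for a, a' in A and every c, and likewise
    in B ([mul_sliding], [lie_sliding]); for the product it is the Leibniz
    rule applied to aa' = 0, whose term in D disappears because it carries the
    factor aa'.  This rule alone makes the argument of Ito's theorem work for
    both operations at once: it yields
      f(a,a',b,b') := m([[a,b],a'],b') = - m(a,[[a',b'],b])
    ([sliding_transfer]), so that f is symmetric in a, a' and in b, b', and
      m([a,b],[a',b']) = f + g
    ([sliding_split]), g being f with the roles of A and B exchanged.
    For the bracket, antisymmetry turns the transfer identity into g = - f.
    For the product, expanding [[a',b]b',a] in two ways gives g = - f too.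

    Once I ** I = 0, the derivation term of the Leibniz rule vanishes on I,
    because D maps I to itself; [ab,w] for w in I thus reduces to
    a[b,w] + [a,w]b, which the two mechanisms annihilate. *)

Set Implicit Arguments.
Unset Strict Implicit.
Unset Printing Implicit Defensive.

Import GRing.Theory.
Local Open Scope gpoisson_scope.

(** * Biadditive operations and identities of generalized Poisson algebras *)

Definition biadditive (V : zmodType) (m : V -> V -> V) : Prop :=
  (forall z, {morph m^~ z : x y / x + y}) /\
  (forall z, {morph m z : x y / x + y}).

Section Biadditive.
Variables (V : zmodType) (m : V -> V -> V) (madd : biadditive m).

Lemma biaddDl x y z : m (x + y) z = m x z + m y z.
Proof. exact: (proj1 madd z x y). Qed.

Lemma biaddDr z x y : m z (x + y) = m z x + m z y.
Proof. exact: (proj2 madd z x y). Qed.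

Lemma biadd0l z : m 0 z = 0.
Proof. by apply: (addIr (m 0 z)); rewrite -biaddDl !add0r. Qed.

Lemma biadd0r z : m z 0 = 0.
Proof. by apply: (addIr (m z 0)); rewrite -biaddDr !add0r. Qed.

Lemma biaddNl x z : m (- x) z = - m x z.
Proof. by apply: (addIr (m x z)); rewrite -biaddDl !addNr biadd0l. Qed.

Lemma biaddNr z x : m z (- x) = - m z x.
Proof. by apply: (addIr (m z x)); rewrite -biaddDr !addNr biadd0r. Qed.

End Biadditive.

Section Identities.
Variables (F : fieldType) (P : ncGenPoissonType F).
Implicit Types (x y z : P) (A B : set P).

Lemma linear_morphD (f : P -> P) : linear f -> {morph f : x y / x + y}.
Proof. by move=> lf x y; rewrite -[x]scale1r lf !scale1r. Qed.

Lemma gp_mul_biadditive : biadditive (@gp_mul F P).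
Proof.
split=> z; first exact/linear_morphD/gp_mul_linearl.
exact/linear_morphD/gp_mul_linearr.
Qed.

Lemma gp_lie_biadditive : biadditive (@gp_lie F P).
Proof.
split=> z; first exact/linear_morphD/gp_lie_linearl.
exact/linear_morphD/gp_lie_linearr.
Qed.

Definition mulE := (biaddDl gp_mul_biadditive, biaddDr gp_mul_biadditive,
  biadd0l gp_mul_biadditive, biadd0r gp_mul_biadditive,
  biaddNl gp_mul_biadditive, biaddNr gp_mul_biadditive).

Definition lieE := (biaddDl gp_lie_biadditive, biaddDr gp_lie_biadditive,
  biadd0l gp_lie_biadditive, biadd0r gp_lie_biadditive,
  biaddNl gp_lie_biadditive, biaddNr gp_lie_biadditive).

Lemma gp_leibnizr x y z :
  [lie z, x ** y] = x ** [lie z, y] + [lie z, x] ** y - x ** y ** gp_der z.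
Proof.
by rewrite gp_lieC gp_leibniz !opprD (gp_lieC z y) (gp_lieC z x) !mulE.
Qed.

(** The operators ad x and ad z commute when [lie x, z] = 0; read on y, this
    exchanges the two outer arguments. *)
Lemma lie_swap x y z :
  [lie x, z] = 0 -> [lie [lie x, y], z] = [lie [lie z, y], x].
Proof.
move=> xz0; have := gp_jacobi x y z.
rewrite (gp_lieC z x) xz0 oppr0 lieE addr0 => /eqP.
rewrite addr_eq0 => /eqP e.
by rewrite (gp_lieC [lie x, y]) (gp_lieC [lie z, y]) (gp_lieC z y) lieE opprK e.
Qed.

(** * The square of the algebra *)

Inductive gp_square : P -> Prop :=
| Square_mul x y : gp_square (x ** y)
| Square_lie x y : gp_square [lie x, y]
| Square_lin c x y : gp_square x -> gp_square y -> gp_square (c *: x + y).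

Lemma square_der w : gp_square w -> gp_square (gp_der w).
Proof.
have sqD x y : gp_square x -> gp_square y -> gp_square (x + y).
  by move=> sx sy; rewrite -[x]scale1r; apply: Square_lin.
elim=> {w} [x y|x y|c x y _ sx _ sy].
- by rewrite gp_der_mul; apply: sqD; apply: Square_mul.
- by rewrite gp_der_lie; apply: sqD; apply: Square_lie.
by rewrite gp_der_linear; apply: Square_lin.
Qed.

Lemma gp_square_subspace : subspace gp_square.
Proof.
split.
  by apply/mem_set; rewrite -[X in gp_square X](biadd0l gp_mul_biadditive 0);
     apply: Square_mul.
by move=> c x y; rewrite !in_setE; apply: Square_lin.
Qed.

Definition square_ideal : gp_ideal P :=
  GPIdeal gp_square_subspace (fun x u _ => Square_mul x u)
    (fun u x _ => Square_mul u x) (fun x u _ => Square_lie x u) square_der.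

Lemma quot_square_abelian : abelian_on [set: gp_quot square_ideal].
Proof.
move=> u v _ _; rewrite -[u]gp_reprK -[v]gp_reprK -gp_pi_mul -gp_pi_lie.
by split; apply/gp_pi0; [apply: Square_mul | apply: Square_lie].
Qed.

(** * Sliding operations in a factorized algebra *)

(** The condition is symmetric in A and B ([factorizationC]), so that each fact
    about ab is also one about ba. *)
Definition factorization A B : Prop :=
  [/\ abelian_on A, abelian_on B
    & forall x, exists a, exists2 b, A a /\ B b & x = a + b].

Lemma factorizationC A B : factorization A B -> factorization B A.
Proof.
by case=> aA aB d; split=> // x; have [a [b [Aa Bb] ->]] := d x;
   exists b, a => //; rewrite addrC.
Qed.

(** The one property of the product and of the bracket that the arguments
    common to both of them rely on. *)
Definition sliding (m : P -> P -> P) A : Prop :=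
  forall a a', A a -> A a' ->
    m a a' = 0 /\ forall c, m [lie a, c] a' = - m a [lie a', c].

Lemma lie_sliding A : abelian_on A -> sliding (@gp_lie F P) A.
Proof.
move=> aA a a' Aa Aa'; have [_ l0] := aA a a' Aa Aa'; split=> // c.
by rewrite lie_swap // gp_lieC.
Qed.

(** This is the Leibniz rule for [lie a ** a', c] = 0: the term
    a ** a' ** D(c) vanishes together with a ** a'. *)
Lemma mul_sliding A : abelian_on A -> sliding (@gp_mul F P) A.
Proof.
move=> aA a a' Aa Aa'; have [m0 _] := aA a a' Aa Aa'; split=> // c.
have := gp_leibniz a a' c; rewrite m0 lieE mulE addr0 addrC => /esym/eqP.
by rewrite addr_eq0 => /eqP.
Qed.

Section Sliding.
Variables (m : P -> P -> P) (madd : biadditive m).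

(** Both sides equal m(b2,a1), where b2 is the B-part of [lie a, b] and a1 the
    A-part of [lie a', b']: the left side slides b' along B, the right side
    slides a1 along A. *)
Lemma sliding_transfer A B a b a' b' : factorization A B ->
    sliding m A -> sliding m B -> A a -> A a' -> B b -> B b' ->
  m [lie [lie a, b], a'] b' = - m a [lie [lie a', b'], b].
Proof.
move=> [aA aB dec] sA sB Aa Aa' Bb Bb'.
have [a2 [b2 [Aa2 Bb2] e2]] := dec [lie a, b].
have [a1 [b1 [Aa1 Bb1] e1]] := dec [lie a', b'].
transitivity (m b2 a1).
  rewrite e2 lieE (aA _ _ Aa2 Aa').2 add0r (sB _ _ Bb2 Bb').2 gp_lieC.
  by rewrite (biaddNr madd) opprK e1 (biaddDr madd) (sB _ _ Bb2 Bb1).1 addr0.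
rewrite e1 lieE (aB _ _ Bb1 Bb).2 addr0 -(sA _ _ Aa Aa1).2 e2.
by rewrite (biaddDl madd) (sA _ _ Aa2 Aa1).1 add0r.
Qed.

(** Splitting [lie a', b'] into its A- and B-parts and sliding each of them
    into the first factor gives the two terms. *)
Lemma sliding_split A B a b a' b' : factorization A B ->
    sliding m A -> sliding m B -> A a -> A a' -> B b -> B b' ->
  m [lie a, b] [lie a', b'] =
    m [lie [lie a, b], a'] b' + m [lie [lie b, a], b'] a'.
Proof.
move=> fAB sA sB Aa Aa' Bb Bb'.
rewrite (sliding_transfer fAB) //.
rewrite (sliding_transfer (factorizationC fAB)) //.
have [aA aB dec] := fAB.
have [a1 [b1 [Aa1 Bb1] e1]] := dec [lie a', b'].
rewrite (gp_lieC b' a') e1 !lieE (aB _ _ Bb1 Bb).2 (aA _ _ Aa1 Aa).2.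
rewrite addr0 add0r (biaddNr madd) opprK (biaddDr madd).
rewrite (sA _ _ Aa Aa1).2 (gp_lieC a b) (biaddNl madd).
by rewrite (sB _ _ Bb Bb1).2 opprK.
Qed.

Lemma sliding_symA A a b a' b' : abelian_on A -> A a -> A a' ->
  m [lie [lie a, b], a'] b' = m [lie [lie a', b], a] b'.
Proof. by move=> aA Aa Aa'; rewrite lie_swap // (aA _ _ Aa Aa').2. Qed.

(** The symmetry in b and b' is invisible on the left form of the transfer
    identity and obvious on its right form. *)
Lemma sliding_symB A B a b a' b' : factorization A B ->
    sliding m A -> sliding m B -> A a -> A a' -> B b -> B b' ->
  m [lie [lie a, b], a'] b' = m [lie [lie a, b'], a'] b.
Proof.
move=> fAB sA sB Aa Aa' Bb Bb'; have [aA aB _] := fAB.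
rewrite !(sliding_transfer fAB) //; congr (- m _ _).
by rewrite (gp_lieC a' b') (gp_lieC a' b) !lieE lie_swap // (aB _ _ Bb' Bb).2.
Qed.

End Sliding.

(** * Vanishing of the products of generators of the square *)

Section Factorization.
Variables A B : set P.
Hypothesis fAB : factorization A B.

Let aA : abelian_on A. Proof. by case: fAB. Qed.
Let aB : abelian_on B. Proof. by case: fAB. Qed.
Let dec x : exists a, exists2 b, A a /\ B b & x = a + b.
Proof. by case: fAB. Qed.
Let smA := mul_sliding aA.
Let smB := mul_sliding aB.
Let slA := lie_sliding aA.
Let slB := lie_sliding aB.

(** The A-part of x is killed by a and its B-part by b. *)
Lemma sandwich a x b : A a -> B b -> a ** x ** b = 0.
Proof.
move=> Aa Bb; have [a' [b' [Aa' Bb'] ->]] := dec x.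
by rewrite mulE (aA Aa Aa').1 add0r -gp_mulA (aB Bb' Bb).1 mulE.
Qed.

Lemma mul4_eq0 a b x y : A a -> B b -> (a ** b) ** (x ** y) = 0.
Proof.
move=> Aa Bb; have [a1 [b1 [Aa1 Bb1] ->]] := dec x.
rewrite gp_mulA mulE -(gp_mulA a b b1) (aB Bb Bb1).1 !mulE addr0.
have [a2 [b2 [Aa2 Bb2] ->]] := dec y.
rewrite mulE -(gp_mulA _ a1) (aA Aa1 Aa2).1 !mulE add0r.
by rewrite -(gp_mulA a) sandwich.
Qed.

Lemma lie_mul_eq0 a b a' b' : A a -> B b -> A a' -> B b' ->
  [lie a, b] ** (a' ** b') = 0.
Proof.
move=> Aa Bb Aa' Bb'.
by rewrite gp_mulA (smA Aa Aa').2 mulE sandwich ?oppr0.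
Qed.

Lemma mul_lie_eq0 a b a' b' : A a -> B b -> A a' -> B b' ->
  (a' ** b') ** [lie a, b] = 0.
Proof.
move=> Aa Bb Aa' Bb'; rewrite -gp_mulA gp_lieC mulE -(smB Bb' Bb).2.
by rewrite gp_mulA sandwich.
Qed.

(** In f + g the bracket allows one more move: f rewrites by symmetry and
    transfer to - [lie a', [lie [lie a, b], b']], which is - g by
    antisymmetry. *)
Lemma lie_lie_eq0 a b a' b' : A a -> B b -> A a' -> B b' ->
  [lie [lie a, b], [lie a', b']] = 0.
Proof.
move=> Aa Bb Aa' Bb'.
rewrite (sliding_split gp_lie_biadditive fAB) //.
rewrite (sliding_symA gp_lie _ _ aA) // (sliding_symB gp_lie_biadditive fAB) //.
rewrite (sliding_transfer gp_lie_biadditive fAB) //.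
by rewrite -gp_lieC (gp_lieC b a) !lieE subrr.
Qed.

(** The value X = f + g is unchanged when a and a' are exchanged.  Expanding
    [lie [lie a', b] ** b', a], once directly and once after sliding b',
    gives X - g = f - X, since the two terms in D(a) agree.
    As X = f + g, this leaves f = - g. *)
Lemma mul_lie_lie_eq0 a b a' b' : A a -> B b -> A a' -> B b' ->
  [lie a, b] ** [lie a', b'] = 0.
Proof.
move=> Aa Bb Aa' Bb'.
have fBA := factorizationC fAB.
set f := [lie [lie a, b], a'] ** b'; set g := [lie [lie b, a], b'] ** a'.
have X : [lie a, b] ** [lie a', b'] = f + g.
  exact: (sliding_split gp_mul_biadditive fAB).
have X' : [lie a', b] ** [lie a, b'] = f + g.
  rewrite (sliding_split gp_mul_biadditive fAB) // /f /g.
  congr (_ + _); first exact: (sliding_symA gp_mul _ _ aA).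
  exact: (sliding_symB gp_mul_biadditive fBA).
have e : [lie a', b] ** b' = b ** [lie b', a'].
  by rewrite gp_lieC mulE (smB Bb Bb').2 opprK.
have h := gp_leibniz [lie a', b] b' a.
rewrite {1}e gp_leibniz e in h.
move/addIr: h; rewrite (gp_lieC b' a) [_ ** - _]mulE X'.
rewrite (sliding_symA gp_mul _ _ aA Aa' Aa) -/f.
have gE : b ** [lie [lie b', a'], a] = - g.
  by rewrite /g (sliding_transfer gp_mul_biadditive fBA) // opprK.
rewrite gE (gp_lieC b a) (gp_lieC b' a') !mulE !opprK X.
by rewrite addrC addrK opprD addrAC addNr add0r => ->; rewrite addNr.
Qed.

(** These are the two terms without derivation in the Leibniz expansion of
    [lie a ** b, [lie a', b']]: by transfer the first is f(a,a',b,b') and the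
    second - f(a',a,b',b), and f is symmetric. *)
Lemma leibniz_lie_eq0 a b a' b' : A a -> B b -> A a' -> B b' ->
  a ** [lie b, [lie a', b']] + [lie a, [lie a', b']] ** b = 0.
Proof.
move=> Aa Bb Aa' Bb'.
rewrite (gp_lieC b) (gp_lieC a) !mulE.
rewrite -(sliding_transfer gp_mul_biadditive fAB) //.
rewrite (sliding_symA gp_mul _ _ aA) //.
by rewrite (sliding_symB gp_mul_biadditive fAB) // subrr.
Qed.

(** When x ** y and [lie x, y] are expanded along P = A + B, the terms that
    stay inside A or inside B vanish. *)
Lemma gp_square_ind_factor (Q : P -> Prop) :
    (forall c x y, Q x -> Q y -> Q (c *: x + y)) ->
    (forall a b, A a -> B b -> [/\ Q (a ** b), Q (b ** a) & Q [lie a, b]]) ->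
  forall x, gp_square x -> Q x.
Proof.
move=> Qlin Qgen.
have QD x y : Q x -> Q y -> Q (x + y).
  by move=> Qx Qy; rewrite -[x]scale1r; apply: Qlin.
move=> z; elim=> {z} [x y|x y|c x y _ Qx _ Qy]; last exact: Qlin.
- have [a [b [Aa Bb] ->]] := dec x; have [a' [b' [Aa' Bb'] ->]] := dec y.
  rewrite !mulE (aA Aa Aa').1 (aB Bb Bb').1 add0r addr0.
  have [Qab _ _] := Qgen a b' Aa Bb'; have [_ Qba _] := Qgen a' b Aa' Bb.
  exact: QD.
have [a [b [Aa Bb] ->]] := dec x; have [a' [b' [Aa' Bb'] ->]] := dec y.
rewrite !lieE (aA Aa Aa').2 (aB Bb Bb').2 add0r addr0.
have [_ _ Qab] := Qgen a b' Aa Bb'; have [_ _ Qba] := Qgen a' b Aa' Bb.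
by rewrite addrC (gp_lieC b) -scaleN1r; apply: Qlin.
Qed.

End Factorization.

(** * The square is abelian *)

Lemma fmul_square_eq0 A B a b w : factorization A B -> A a -> B b ->
  gp_square w -> (a ** b) ** w = 0.
Proof.
move=> fAB Aa Bb; move: w; apply: (gp_square_ind_factor fAB).
  by move=> c x y x0 y0; rewrite gp_mul_linearr x0 y0 scaler0 addr0.
by move=> a' b' Aa' Bb'; split;
  [exact: (mul4_eq0 fAB) | exact: (mul4_eq0 fAB) | exact: (mul_lie_eq0 fAB)].
Qed.

Lemma flie_square_eq0 A B a b w : factorization A B -> A a -> B b ->
  gp_square w -> [lie a, b] ** w = 0.
Proof.
move=> fAB Aa Bb; move: w; apply: (gp_square_ind_factor fAB).
  by move=> c x y x0 y0; rewrite gp_mul_linearr x0 y0 scaler0 addr0.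
move=> a' b' Aa' Bb'; split.
- exact: (lie_mul_eq0 fAB).
- by rewrite gp_lieC mulE (lie_mul_eq0 (factorizationC fAB)) ?oppr0.
exact: (mul_lie_lie_eq0 fAB).
Qed.

Lemma square_mul_eq0 A B u w : factorization A B ->
  gp_square u -> gp_square w -> u ** w = 0.
Proof.
move=> fAB squ sqw; move: u squ; apply: (gp_square_ind_factor fAB).
  by move=> c x y x0 y0; rewrite gp_mul_linearl x0 y0 scaler0 addr0.
move=> a b Aa Bb; split.
- exact: (fmul_square_eq0 fAB).
- exact: (fmul_square_eq0 (factorizationC fAB)).
exact: (flie_square_eq0 fAB).
Qed.

(** As w lies in the square, so does D(w); the derivation term of the Leibniz
    rule is then a product of two elements of the square. *)
Lemma lie_fmul_square_eq0 A B a b w : factorization A B -> A a -> B b ->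
  gp_square w -> [lie a ** b, w] = 0.
Proof.
move=> fAB Aa Bb sqw; have [aA aB _] := fAB.
rewrite gp_leibniz (square_mul_eq0 fAB (Square_mul _ _) (square_der sqw)) addr0.
move: w sqw; apply: (gp_square_ind_factor fAB).
  move=> c x y x0 y0; rewrite !gp_lie_linearr gp_mul_linearl gp_mul_linearr.
  by rewrite addrACA -scalerDr x0 y0 scaler0 addr0.
move=> a' b' Aa' Bb'; split; last exact: (leibniz_lie_eq0 fAB).
- rewrite !gp_leibnizr (aA _ _ Aa Aa').2 (aB _ _ Bb Bb').2 !mulE.
  rewrite -(gp_mulA _ (gp_der a)) (mul4_eq0 fAB) // !gp_mulA (aA _ _ Aa Aa').1.
  by rewrite !mulE !(sandwich fAB) // !(addr0, oppr0).
rewrite !gp_leibnizr (aA _ _ Aa Aa').2 (aB _ _ Bb Bb').2 !mulE.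
rewrite -(gp_mulA _ (gp_der a)) (mul4_eq0 (factorizationC fAB)) //.
rewrite -(gp_mulA b') !gp_mulA -(gp_mulA _ a') (mul4_eq0 fAB) //.
rewrite (fmul_square_eq0 fAB _ _ (Square_lie _ _)) //.
rewrite -(gp_mulA _ a') (flie_square_eq0 fAB _ _ (Square_mul _ _)) //.
by rewrite !(addr0, oppr0).
Qed.

Lemma square_lie_eq0 A B u w : factorization A B ->
  gp_square u -> gp_square w -> [lie u, w] = 0.
Proof.
move=> fAB squ; move: u squ w; apply: (gp_square_ind_factor fAB).
  move=> c x y x0 y0 w sqw; rewrite gp_lie_linearl.
  by rewrite x0 // y0 // scaler0 addr0.
have fBA := factorizationC fAB.
move=> a b Aa Bb; split=> w.
- exact: lie_fmul_square_eq0 fAB Aa Bb.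
- exact: lie_fmul_square_eq0 fBA Bb Aa.
move: w; apply: (gp_square_ind_factor fAB).
  by move=> c x y x0 y0; rewrite gp_lie_linearr x0 y0 scaler0 addr0.
move=> a' b' Aa' Bb'; split.
- by rewrite gp_lieC (lie_fmul_square_eq0 fAB) ?oppr0 //; apply: Square_lie.
- by rewrite gp_lieC (lie_fmul_square_eq0 fBA) ?oppr0 //; apply: Square_lie.
exact: (lie_lie_eq0 fAB).
Qed.

Lemma factorization_metatrivial A B : factorization A B -> metatrivial P.
Proof.
move=> fAB; exists square_ideal; split; last exact: quot_square_abelian.
move=> u v squ sqv.
by split; [apply: (square_mul_eq0 fAB) | apply: (square_lie_eq0 fAB)].
Qed.

End Identities.

Unset Implicit Arguments.

(** * Ito's theorem *)

Theorem theorem5p3 (F : closedFieldType) (charF0 : [pchar F] =i pred0)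
    (P : ncGenPoissonType F) (A B : set P)
    (subA : subalgebra A) (subB : subalgebra B)
    (abA : abelian_on A) (abB : abelian_on B)
    (sumAB : [set a + b | a in A & b in B] = [set: P]) :
  metatrivial P.
Proof.
apply: (@factorization_metatrivial F P A B); split=> // x.
have : [set: P] x by [].
by rewrite -sumAB => -[a Aa [b Bb <-]]; exists a, b.
Qed.
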